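(* Let $S$ and $T$ be linear operators in a vector space $X$ over $\mathbb K$, with domains $\operatorname{dom} S$ and $\operatorname{dom} T$ (linear subspaces of $X$), and let $k$ be a non-negative integer. Assume that there exists a linear subspace $M\subseteq \operatorname{dom} S\cap\operatorname{dom} T$ such that $Sx=Tx$ for all $x\in M$ and $$\max\bigl\{\dim(\operatorname{dom} S/M),\ \dim(\operatorname{dom} T/M)\bigr\}=k<\infty .$$ Then the following holds for every $\lambda\in\mathbb K$: (i) If $\ker(S-\lambda)^n$ is finite dimensional for some $n\in\mathbb N$, then $\ker(T-\lambda)^n$ is finite dimensional (for the same $n$) and $$\bigl|\dim\ker(S-\lambda)^n-\dim\ker(T-\lambda)^n\bigr|\le k\,n .$$ (ii) If $\ker(S-\lambda)^{n+1}/\ker(S-\lambda)^n$ is finite dimensional for some $n\in\mathbb N$, then $\ker(T-\lambda)^{n+1}/\ker(T-\lambda)^n$ is finite dimensional (for the same $n$) and $$\left|\dim\left(\frac{\ker(S-\lambda)^{n+1}}{\ker(S-\lambda)^n}\right)-\dim\left(\frac{\ker(T-\lambda)^{n+1}}{\ker(T-\lambda)^n}\right)\right|\le k .$$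
   Context: $\mathbb K$ is $\mathbb R$ or $\mathbb C$; $X$ is an arbitrary (possibly infinite dimensional) vector space over $\mathbb K$; $\mathbb N=\{1,2,\dots\}$. A linear operator $A$ in $X$ is a linear map $A:\operatorname{dom} A\to X$ defined on a linear subspace $\operatorname{dom} A\subseteq X$. Here $A-\lambda$ has domain $\operatorname{dom} A$, and powers have their natural domains: $\operatorname{dom} A^{1}=\operatorname{dom} A$, $\operatorname{dom} A^{n+1}=\{x\in\operatorname{dom} A^n: A^n x\in\operatorname{dom} A\}$, $A^{n+1}x=A(A^nx)$, and $\ker A^n=\{x\in\operatorname{dom} A^n: A^nx=0\}$. *)

(* Defs.v *)
From HB Require Import structures.
From mathcomp Require Import all_boot all_order all_algebra generic_quotient ring_quotient.
From mathcomp Require Import complex.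
From mathcomp Require Import boolp classical_sets reals.

Set Implicit Arguments.
Unset Strict Implicit.
Unset Printing Implicit Defensive.

Import Order.TTheory GRing.Theory Num.Theory.
Local Open Scope ring_scope.
Local Open Scope quotient_scope.

Variant scalar_kind := RealScalars | ComplexScalars.

Definition scalars (R : realType) (s : scalar_kind) : fieldType :=
  match s with
  | RealScalars => R
  | ComplexScalars => R[i]
  end.

(* The quotient vector space X / M.  The library quotient needs a [zmodClosed]
   predicate, which [submodClosed] does not coerce to, hence the alias. *)
Section QuotientSpace.
Variables (F : fieldType) (X : lmodType F) (M : submodClosed X).

Definition submod_pred : {pred X} := M.

Fact submod_pred_zmod_closed : zmod_closed submod_pred.
Proof.
split=> [|x y Mx My]; first exact: (rpred0 M).
by rewrite /submod_pred -scaleN1r; apply: (rpredD (S := M)) => //; apply: (rpredZ (s := M)).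
Qed.

HB.instance Definition _ :=
  GRing.isZmodClosed.Build X submod_pred submod_pred_zmod_closed.

Definition quot_space : Type := {ideal_quot submod_pred}.

HB.instance Definition _ := GRing.Zmodule.on quot_space.
HB.instance Definition _ := EqQuotient.on quot_space.

Definition quot_proj (x : X) : quot_space := \pi_{ideal_quot submod_pred} x.

Definition quot_scale (a : F) (q : quot_space) : quot_space :=
  quot_proj (a *: repr q).

Fact quot_projP x y : (quot_proj x = quot_proj y) <-> (x - y \in M).
Proof.
rewrite /quot_proj -[x - y \in M]/(x - y \in submod_pred) Quotient.idealrBE.
by split=> [->|/eqP].
Qed.

Fact quot_projD : {morph quot_proj : x y / x + y}.
Proof. by move=> x y; rewrite /quot_proj raddfD. Qed.

Fact quot_projK (q : quot_space) : quot_proj (repr q) = q.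
Proof. exact: reprK. Qed.

Fact quot_projZ a x : quot_proj (a *: x) = quot_scale a (quot_proj x).
Proof.
apply/quot_projP; rewrite -scalerBr; apply: (rpredZ (s := M)).
by apply/quot_projP; rewrite quot_projK.
Qed.

Fact quot_scaleA a b q :
  quot_scale a (quot_scale b q) = quot_scale (a * b) q.
Proof. by rewrite -(quot_projK q) -!quot_projZ scalerA. Qed.

Fact quot_scale1 : left_id 1 quot_scale.
Proof. by move=> q; rewrite -(quot_projK q) -quot_projZ scale1r. Qed.

Fact quot_scaleDr : right_distributive quot_scale +%R.
Proof.
move=> a p q; rewrite -(quot_projK p) -(quot_projK q).
by rewrite -quot_projD -!quot_projZ scalerDr quot_projD.
Qed.

Fact quot_scaleDl q : {morph quot_scale^~ q : a b / a + b}.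
Proof.
by move=> a b; rewrite -(quot_projK q) -!quot_projZ scalerDl quot_projD.
Qed.

HB.instance Definition _ := GRing.Zmodule_isLmodule.Build F quot_space
  quot_scaleA quot_scale1 quot_scaleDr quot_scaleDl.

Section QuotientSubspace.
Variable U : submodClosed X.

Definition quot_sub_pred : {pred quot_space} :=
  [pred q | `[< exists2 x, x \in U & q = quot_proj x >]].

Fact quot_sub_pred_closed : subsemimod_closed quot_sub_pred.
Proof.
apply: GRing.submod_closed_semi; split=> [|a p q].
  apply/asboolP; exists 0; first exact: rpred0.
  by apply: (addrI (quot_proj 0)); rewrite -quot_projD !addr0.
move=> /asboolP[x Ux ->] /asboolP[y Uy ->]; apply/asboolP.
exists (a *: x + y); first by rewrite rpredD ?rpredZ.
by rewrite quot_projD quot_projZ.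
Qed.

HB.instance Definition _ :=
  GRing.isSubmodClosed.Build F quot_space quot_sub_pred quot_sub_pred_closed.

(* For M <= U, this is U / M seen as a linear subspace of X / M. *)
Definition quot_sub : submodClosed quot_space := quot_sub_pred.

End QuotientSubspace.

End QuotientSpace.

Section Dimension.
Variables (F : fieldType) (V : lmodType F).
Implicit Type W : submodClosed V.

Definition is_basis W n (e : 'I_n -> V) : Prop :=
  [/\ forall i, e i \in W,
      forall c : 'I_n -> F, \sum_i c i *: e i = 0 -> forall i, c i = 0
    & forall x, x \in W -> exists c : 'I_n -> F, x = \sum_i c i *: e i].

Definition has_dim W (n : nat) : Prop := exists e : 'I_n -> V, is_basis W e.

Definition fin_dim W : Prop := exists n, has_dim W n.

(* Junk value 0 when W is not finite dimensional. *)
Definition subdim W : nat := xget 0%N [set n | has_dim W n]%classic.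

End Dimension.

Notation fin_dim_quot U M := (fin_dim (quot_sub M U)).
Notation dim_quot U M := (subdim (quot_sub M U)).

Section Operators.
Variables (F : fieldType) (X : lmodType F).

(* The values of [op_fun] outside [dom] are irrelevant. *)
Record linop := LinOp {
  dom : submodClosed X;
  op_fun :> X -> X;
  linopP : forall (a : F) (x y : X), x \in dom -> y \in dom ->
    op_fun (a *: x + y) = a *: op_fun x + op_fun y
}.

Fact linop0 (A : linop) : A 0 = 0.
Proof.
have D0 : 0 \in dom A by apply: rpred0.
have := linopP (-1) D0 D0; rewrite scaler0 addr0 => ->.
by rewrite scaleN1r addNr.
Qed.

Definition full_pred : {pred X} := predT.
Fact full_pred_closed : subsemimod_closed full_pred.
Proof. by split; [split|]. Qed.
HB.instance Definition _ :=
  GRing.isSubmodClosed.Build F X full_pred full_pred_closed.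

Definition id_op : linop :=
  @LinOp full_pred id (fun a x y _ _ => erefl (a *: x + y)).

Section Shift.
Variables (A : linop) (l : F).
Fact shift_op_linear (a : F) (x y : X) : x \in dom A -> y \in dom A ->
  A (a *: x + y) - l *: (a *: x + y) = a *: (A x - l *: x) + (A y - l *: y).
Proof.
move=> Ax Ay; rewrite linopP // scalerBr scalerDr !scalerA mulrC opprD.
by rewrite addrACA.
Qed.
Definition shift_op : linop := LinOp shift_op_linear.
End Shift.

Section Comp.
Variables A B : linop.
Definition comp_dom : {pred X} := [pred x | (x \in dom B) && (B x \in dom A)].
Fact comp_dom_closed : subsemimod_closed comp_dom.
Proof.
apply: GRing.submod_closed_semi; split=> [|a x y]; rewrite !inE.
  by rewrite linop0 !rpred0.
move=> /andP[Bx ABx] /andP[By ABy].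
by rewrite linopP // !rpredD ?rpredZ.
Qed.
HB.instance Definition _ :=
  GRing.isSubmodClosed.Build F X comp_dom comp_dom_closed.
Fact comp_op_linear (a : F) (x y : X) : x \in comp_dom -> y \in comp_dom ->
  A (B (a *: x + y)) = a *: A (B x) + A (B y).
Proof. by move=> /andP[Bx ABx] /andP[By ABy]; rewrite !linopP. Qed.
Definition comp_op : linop := @LinOp comp_dom (A \o B) comp_op_linear.
End Comp.

(* A ^ 0 is the identity of X, so that A ^ 1 has domain dom A. *)
Fixpoint pow_op (A : linop) (n : nat) : linop :=
  if n is m.+1 then comp_op A (pow_op A m) else id_op.

Section Ker.
Variable A : linop.
Definition ker_pred : {pred X} := [pred x | (x \in dom A) && (A x == 0)].
Fact ker_pred_closed : subsemimod_closed ker_pred.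
Proof.
apply: GRing.submod_closed_semi; split=> [|a x y]; rewrite !inE.
  by rewrite linop0 eqxx rpred0.
move=> /andP[Ax /eqP Ax0] /andP[Ay /eqP Ay0].
by rewrite linopP // Ax0 Ay0 scaler0 addr0 eqxx rpredD ?rpredZ.
Qed.
HB.instance Definition _ :=
  GRing.isSubmodClosed.Build F X ker_pred ker_pred_closed.
Definition ker : submodClosed X := ker_pred.
End Ker.

End Operators.

Notation ker_shift_pow A l n := (ker (pow_op (shift_op A l) n)).

(* Main.v *)
(* Let A be the common restriction of S - l and T - l to M; it suffices to
   compare A with each of its two extensions B.  If dom B / dom A has dimension
   at most k, then ker B^(n+1) lies in ker A^(n+1) + ker B^n + (span of k
   vectors); by induction on k this reduces to codimension 1, where a single
   Jordan chain suffices to correct all the others.  Since ker A^(n+1) meets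
   ker (S-l)^n in ker A^n, a bound for ker (S-l)^(n+1) / ker (S-l)^n passes to
   ker A^(n+1) / ker A^n, and from there to ker (T-l)^(n+1) / ker (T-l)^n at
   the cost of k; this is (ii).  Iterating the inclusion from ker B^0 = 0 puts
   ker B^n in ker A^n + (span of k n vectors), which is (i). *)
Require Import Defs.
From HB Require Import structures.
From mathcomp Require Import all_boot all_order all_algebra.
From mathcomp Require Import boolp classical_sets.
From mathcomp Require Import reals.
From mathcomp Require Import zify.

Set Implicit Arguments.
Unset Strict Implicit.
Unset Printing Implicit Defensive.

Import Order.TTheory GRing.Theory Num.Theory.
Local Open Scope ring_scope.

(** * Spanning families and bases of one subspace modulo another *)

Section SpansMod.
Variables (F : fieldType) (X : lmodType F).
Implicit Types (U V W : submodClosed X).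

Lemma submodB U x y : x \in U -> y \in U -> x - y \in U.
Proof. by move=> Ux Uy; rewrite -scaleN1r rpredD ?rpredZ. Qed.

(* The vectors are not required to lie in [U]. *)
Definition spans_mod U V k := exists e : 'I_k -> X,
  forall x, x \in U -> exists c : 'I_k -> F, x - \sum_i c i *: e i \in V.

Definition cat_ord T j k (e : 'I_j -> T) (f : 'I_k -> T) (i : 'I_(j + k)) : T :=
  match split i with inl a => e a | inr b => f b end.

Lemma cat_ord_lshift T j k (e : 'I_j -> T) (f : 'I_k -> T) i :
  cat_ord e f (lshift k i) = e i.
Proof. by rewrite /cat_ord (unsplitK (inl _ i)). Qed.

Lemma cat_ord_rshift T j k (e : 'I_j -> T) (f : 'I_k -> T) i :
  cat_ord e f (rshift j i) = f i.
Proof. by rewrite /cat_ord (unsplitK (inr _ i)). Qed.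

Definition cat_ordE := (cat_ord_lshift, cat_ord_rshift).

Lemma sum_cat_ord j k (e : 'I_j -> X) (f : 'I_k -> X) c d :
  \sum_i cat_ord c d i *: cat_ord e f i =
  \sum_i c i *: e i + \sum_i d i *: f i.
Proof.
by rewrite big_split_ord; congr (_ + _); apply: eq_bigr => i _;
  rewrite !cat_ordE.
Qed.

Lemma spans_mod_trans V U W j k :
  spans_mod U V j -> spans_mod V W k -> spans_mod U W (j + k).
Proof.
move=> [e He] [f Hf]; exists (cat_ord e f) => x /He[c /Hf[d Hd]].
by exists (cat_ord c d); rewrite sum_cat_ord opprD addrA.
Qed.

Lemma spans_mod_sub U V k : {subset U <= V} -> spans_mod U V k.
Proof.
move=> UV; exists (fun=> 0) => x /UV Vx; exists (fun=> 0).
by rewrite big1 ?subr0 // => i _; rewrite scaler0.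
Qed.

Lemma spans_mod_leq U V j k : (j <= k)%N -> spans_mod U V j -> spans_mod U V k.
Proof.
move=> jk sUV; rewrite -(subnKC jk).
by apply: spans_mod_trans sUV _; apply: spans_mod_sub.
Qed.

Definition add_pred U V : {pred X} :=
  [pred x | `[< exists2 y, y \in U & x - y \in V >]].

Fact add_pred_closed U V : subsemimod_closed (add_pred U V).
Proof.
apply: GRing.submod_closed_semi; split=> [|a x y].
  by apply/asboolP; exists 0; rewrite ?subr0 rpred0.
move=> /asboolP[u Uu Vu] /asboolP[v Uv Vv]; apply/asboolP.
exists (a *: u + v); first by rewrite rpredD ?rpredZ.
by rewrite opprD addrACA -scalerBr rpredD ?rpredZ.
Qed.

HB.instance Definition _ U V :=
  GRing.isSubmodClosed.Build F X (add_pred U V) (add_pred_closed U V).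

Definition addsp U V : submodClosed X := add_pred U V.

Lemma spans_mod_addsp U V W j k :
  spans_mod U (addsp V W) j -> spans_mod V W k -> spans_mod U W (j + k).
Proof.
move=> sU [e He]; apply: spans_mod_trans sU _.
exists e => x /asboolP[y /He[c Hc] Wxy]; exists c.
by rewrite -(subrK y x) -addrA rpredD.
Qed.

Section Slice.
Variables (U V : submodClosed X) (k : nat) (e : 'I_k -> X).

(** This is the intersection of [U] with the sum of [V] and the span of [e]. *)
Definition slice_pred : {pred X} :=
  [pred x | (x \in U)
     && `[< exists c : 'I_k -> F, x - \sum_i c i *: e i \in V >]].

Fact slice_pred_closed : subsemimod_closed slice_pred.
Proof.
apply: GRing.submod_closed_semi; split=> [|a x y].
  rewrite inE rpred0; apply/asboolP; exists (fun=> 0).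
  by rewrite big1 ?subr0 ?rpred0 // => i _; rewrite scale0r.
move=> /andP[Ux /asboolP[c Hc]] /andP[Uy /asboolP[d Hd]].
rewrite inE rpredD ?rpredZ //=; apply/asboolP.
exists (fun i => a * c i + d i).
under eq_bigr do rewrite scalerDl -scalerA.
by rewrite big_split -scaler_sumr opprD addrACA -scalerBr rpredD ?rpredZ.
Qed.

HB.instance Definition _ :=
  GRing.isSubmodClosed.Build F X slice_pred slice_pred_closed.

Definition slice : submodClosed X := slice_pred.

End Slice.

(** Equivalently, [U] modulo its intersection with [V] has dimension at most 1. *)
Definition codim1 U V := forall x y, x \in U -> y \in U -> y \notin V ->
  exists c, x - c *: y \in V.

(** Drop the first generator and let [U'] be the slice of [U] by the others. This step drives the
    inductions on [k]. *)
Lemma spans_modS U V k : spans_mod U V k.+1 ->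
  exists U', [/\ {subset U' <= U}, forall x, x \in U -> x \in V -> x \in U',
                 codim1 U U' & spans_mod U' V k].
Proof.
move=> [e He]; pose f i := e (lift ord0 i).
exists (slice U V f); split.
- by move=> x /andP[].
- move=> x Ux Vx; rewrite inE Ux; apply/asboolP; exists (fun=> 0).
  by rewrite big1 ?subr0 // => i _; rewrite scale0r.
- move=> x y Ux Uy ynU'.
  have [c Hc] := He _ Ux; have [d Hd] := He _ Uy.
  (* Otherwise the remaining generators alone would reduce [y] into [V], so [y] would lie in
     [U']. *)
  have d0 : d ord0 != 0.
    apply: contraNneq ynU' => d0; rewrite inE Uy; apply/asboolP.
    exists (fun i => d (lift ord0 i)).
    by move: Hd; rewrite big_ord_recl d0 scale0r add0r.
  (* With this multiple the dropped generator cancels from [x - a *: y]. *)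
  pose a := c ord0 / d ord0; exists a.
  rewrite inE submodB ?rpredZ //=; apply/asboolP.
  exists (fun i => c (lift ord0 i) - a * d (lift ord0 i)).
  have := submodB Hc (rpredZ a Hd).
  rewrite !big_ord_recl scalerBr scalerDr !scalerA divfK // => H.
  under eq_bigr do rewrite scalerBl -scalerA.
  rewrite sumrB -scaler_sumr; congr (_ \in V): H.
  rewrite !opprD !opprK !addrA [LHS](ACl (1*4*3*6*(2*5)))%AC /=.
  by rewrite addNr addr0.
- by exists f => x /andP[_ /asboolP].
Qed.

Definition basis_mod U V k (e : 'I_k -> X) : Prop :=
  [/\ forall i, e i \in U,
      forall c : 'I_k -> F, \sum_i c i *: e i \in V -> forall i, c i = 0
    & forall x, x \in U -> exists c : 'I_k -> F, x - \sum_i c i *: e i \in V].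

(** Peel off generators one by one: each is discarded if [U'] is all of [U], and otherwise replaced
    by any vector of [U] outside [U']. The new generators lie in [U]. *)
Lemma spans_mod_basis U V k : spans_mod U V k ->
  exists2 j, (j <= k)%N & exists e : 'I_j -> X, basis_mod U V e.
Proof.
elim: k U => [|k IHk] U.
  by case=> e He; exists 0%N => //; exists e; split=> // [[]|c _ []].
case/spans_modS=> U' [sU'U UVU' cUU' /IHk[j jk [e [eU' fe se]]]].
have [sUU'|/existsNP[x0 /not_implyP[Ux0 /negP nx0]]] :=
  pselect (forall x, x \in U -> x \in U').
  exists j; first exact: leqW.
  by exists e; split=> // [i|x /sUU' /se //]; apply: sU'U.
exists (1 + j)%N => //; exists (cat_ord (fun=> x0) e); split.
- by move=> i; rewrite /cat_ord; case: split => // a; apply: sU'U.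
- move=> c; rewrite big_split_ord /= big_ord1 cat_ord_lshift.
  under eq_bigr do rewrite cat_ord_rshift.
  set c0 := c _ => Hc.
  have Ue : \sum_i c (rshift 1 i) *: e i \in U'.
    by apply: rpred_sum => i _; rewrite rpredZ.
  (* The whole combination lies in [U] and [V], hence in [U'], and so does its tail; a nonzero [c0]
     would then put [x0] in [U']. *)
  have c00 : c0 = 0.
    apply: contraNeq nx0 => c0n.
    have Us : c0 *: x0 + \sum_i c (rshift 1 i) *: e i \in U.
      by apply: rpredD; [apply: rpredZ|apply: sU'U].
    have := submodB (UVU' _ Us Hc) Ue; rewrite addrK => /(rpredZ c0^-1).
    by rewrite scalerA mulVf // scale1r.
  move: Hc; rewrite c00 scale0r add0r => /fe Hc i.
  rewrite -(splitK i); case: split => a //=.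
  by rewrite ord1 -c00.
- move=> x Ux; have [a /se[c Hc]] := cUU' _ _ Ux Ux0 nx0.
  exists (cat_ord (fun=> a) c).
  by rewrite sum_cat_ord big_ord1 opprD addrA.
Qed.

(** If [j > k], the [j] by [k] matrix of coordinates modulo [V] has a nonzero row vector in its left
    kernel, which is a forbidden relation modulo [V]. *)
Lemma free_mod_leq U V j k (e : 'I_j -> X) :
  (forall i, e i \in U) ->
  (forall c : 'I_j -> F, \sum_i c i *: e i \in V -> forall i, c i = 0) ->
  spans_mod U V k -> (j <= k)%N.
Proof.
move=> Ue fe [f Hf].
have [c Hc] := choice (fun i => Hf _ (Ue i)).
rewrite leqNgt; apply/negP => kj.
pose C := \matrix_(i, l) c i l.
have /rowV0Pn[v /sub_kermxP vC /negP] : kermx C != 0.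
  by rewrite kermx_eq0 neq_ltn (leq_ltn_trans (rank_leq_col C)).
apply; apply/eqP/rowP => i; rewrite mxE; apply: fe i.
have : \sum_i v ord0 i *: (e i - \sum_l c i l *: f l) \in V.
  by apply: rpred_sum => i _; rewrite rpredZ.
under eq_bigr do rewrite scalerBr scaler_sumr.
rewrite sumrB exchange_big /= [X in _ - X]big1 ?subr0 // => l _.
under eq_bigr do rewrite scalerA.
rewrite -scaler_suml (_ : \sum_i _ = 0) ?scale0r //.
have /rowP/(_ l) := vC; rewrite !mxE => vCl; rewrite -[RHS]vCl.
by apply: eq_bigr => i _; rewrite mxE.
Qed.

Lemma basis_mod_spans U V k (e : 'I_k -> X) :
  basis_mod U V e -> spans_mod U V k.
Proof. by case=> _ _ se; exists e. Qed.

(** After [spans_mod_basis] moves the generators into [U], every remainder lies in both [U] and [V],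
    hence in [W]. *)
Lemma spans_modSr U V W k : (forall x, x \in U -> x \in V -> x \in W) ->
  spans_mod U V k -> spans_mod U W k.
Proof.
move=> UVW /spans_mod_basis[j jk [e [Ue _ se]]]; apply: (spans_mod_leq jk).
exists e => x Ux; have [c Hc] := se _ Ux; exists c; apply: UVW => //.
by rewrite submodB //; apply: rpred_sum => i _; rewrite rpredZ.
Qed.

Lemma spans_modSl U U' V k : {subset U' <= U} -> spans_mod U V k ->
  spans_mod U' V k.
Proof. by move=> sU'U [e He]; exists e => x /sU'U; apply: He. Qed.

(** * Translation between spanning bounds and dimensions *)

Lemma mem_ker_id x : (x \in ker (id_op X)) = (x == 0).
Proof. by []. Qed.

(** Here [ker (id_op X)] serves as the zero subspace; it is also the kernel of the zeroth power of
    any operator. *)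
Lemma is_basis_mod0 U n (e : 'I_n -> X) :
  is_basis U e <-> basis_mod U (ker (id_op X)) e.
Proof.
split=> -[Ue fe se].
  split=> // [c|x Ux]; first by rewrite mem_ker_id => /eqP/fe.
  by have [c ->] := se x Ux; exists c; rewrite subrr rpred0.
split=> // [c c0|x Ux]; first by apply: fe; rewrite c0 rpred0.
by have [c] := se x Ux; rewrite mem_ker_id subr_eq0 => /eqP ->; exists c.
Qed.

Lemma has_dim_inj U m n : has_dim U m -> has_dim U n -> m = n.
Proof.
have le j k : has_dim U j -> has_dim U k -> (j <= k)%N.
  move=> [e /is_basis_mod0[Ue fe _]] [f /is_basis_mod0/basis_mod_spans].
  exact: free_mod_leq.
by move=> Um Un; apply/eqP; rewrite eqn_leq !le.
Qed.

Lemma subdimE U n : has_dim U n -> subdim U = n.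
Proof.
move=> Un; rewrite /subdim; case: xgetP => [m _|/(_ n) //].
by move/has_dim_inj; apply.
Qed.

Lemma spans_mod0P U k :
  spans_mod U (ker (id_op X)) k <-> fin_dim U /\ (subdim U <= k)%N.
Proof.
split=> [/spans_mod_basis[j jk [e /is_basis_mod0 He]]|[[n Un]]].
  have Uj : has_dim U j by exists e.
  by split; [exists j|rewrite (subdimE Uj)].
rewrite (subdimE Un) => nk; apply: (spans_mod_leq nk).
by have [e /is_basis_mod0/basis_mod_spans] := Un.
Qed.

Lemma quot_proj_sum V n (c : 'I_n -> F) (e : 'I_n -> X) :
  quot_proj V (\sum_i c i *: e i) = \sum_i c i *: quot_proj V (e i).
Proof.
rewrite (big_morph _ (@quot_projD _ _ V) (_ : quot_proj V 0 = 0)).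
  by apply: eq_bigr => i _; apply: quot_projZ.
by apply: (addrI (quot_proj V 0)); rewrite -quot_projD !addr0.
Qed.

Lemma quot_proj0P V x : quot_proj V x = 0 <-> x \in V.
Proof.
have -> : 0 = quot_proj V 0.
  by apply: (addrI (quot_proj V 0)); rewrite -quot_projD !addr0.
by rewrite quot_projP subr0.
Qed.

Lemma has_dim_quotP U V n :
  has_dim (quot_sub V U) n <-> exists e : 'I_n -> X, basis_mod U V e.
Proof.
split=> [[q [Uq fq sq]]|[e [Ue fe se]]].
  have /choice[e He] i : exists x, x \in U /\ q i = quot_proj V x.
    by have /asboolP[x Ux ->] := Uq i; exists x.
  have qe c : \sum_i c i *: q i = quot_proj V (\sum_i c i *: e i).
    by rewrite quot_proj_sum; apply: eq_bigr => i _; rewrite (He i).2.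
  exists e; split=> [i|c Vc|x Ux]; first by case: (He i).
    by apply: fq; rewrite qe; apply/quot_proj0P.
  have [|c] := sq (quot_proj V x); first by apply/asboolP; exists x.
  by rewrite qe => /quot_projP Hc; exists c.
exists (fun i => quot_proj V (e i)); split=> [i|c|_ /asboolP[x Ux ->]].
- by apply/asboolP; exists (e i).
- by rewrite -quot_proj_sum => /quot_proj0P /fe.
- have [c Hc] := se _ Ux; exists c.
  by rewrite -quot_proj_sum; apply/quot_projP.
Qed.

End SpansMod.

Lemma spans_modP (F : fieldType) (X : lmodType F) (U V : submodClosed X) k :
  spans_mod U V k <-> fin_dim_quot U V /\ (dim_quot U V <= k)%N.
Proof.
split=> [/spans_mod_basis[j jk Hj]|[[n Un]]].
  have {}Hj : has_dim (quot_sub V U) j by apply/has_dim_quotP.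
  by split; [exists j|rewrite (subdimE Hj)].
rewrite (subdimE Un) => nk; apply: (spans_mod_leq nk).
by have /has_dim_quotP[e /basis_mod_spans] := Un.
Qed.

(** * Iterates and kernels of powers under extension of operators *)

Section Extension.
Variables (F : fieldType) (X : lmodType F).
Implicit Types (A T : linop X).

Lemma pow_opE T n x : pow_op T n x = iter n T x.
Proof. by elim: n => //= n ->. Qed.

Lemma mem_dom_pow T n x :
  x \in dom (pow_op T n) <-> (forall i, (i < n)%N -> iter i T x \in dom T).
Proof.
elim: n => [|n IHn]; first by split.
have -> : (x \in dom (pow_op T n.+1)) =
  (x \in dom (pow_op T n)) && (iter n T x \in dom T) by rewrite -pow_opE.
split=> [/andP[/IHn Hx Hn] i|Hx].
  by rewrite ltnS leq_eqVlt => /predU1P[->|/Hx].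
by rewrite Hx // andbT; apply/IHn => i /ltnW; apply: Hx.
Qed.

Lemma iter_linop_eq0 T m n x : (m <= n)%N -> iter m T x = 0 -> iter n T x = 0.
Proof.
move=> /subnK <- x0; rewrite iterD x0.
by elim: (n - m)%N => //= i ->; rewrite linop0.
Qed.

(** From the [n]th on all iterates are 0, so the domain condition can be asked for every [i]; in
    this form it passes from [x] to [T x]. *)
Lemma mem_ker_pow T n x : x \in ker (pow_op T n) <->
  (forall i, iter i T x \in dom T) /\ iter n T x = 0.
Proof.
have -> : (x \in ker (pow_op T n)) =
  (x \in dom (pow_op T n)) && (iter n T x == 0) by rewrite -pow_opE.
split=> [/andP[/mem_dom_pow Hx /eqP x0]|[Hx ->]]; last first.
  by rewrite eqxx andbT; apply/mem_dom_pow.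
split=> // i; have [/Hx //|ni] := ltnP i n.
by rewrite (iter_linop_eq0 ni x0) rpred0.
Qed.

Lemma iter_linopB T n c x y : (forall i, iter i T x \in dom T) ->
  (forall i, iter i T y \in dom T) ->
  iter n T (x - c *: y) = iter n T x - c *: iter n T y.
Proof.
move=> Tx Ty; elim: n => //= n ->.
by rewrite -!scaleNr ![_ + _ *: _]addrC linopP.
Qed.

Definition extends A T := forall x, x \in dom A -> x \in dom T /\ A x = T x.

Lemma extends_iterr A T n x : extends A T ->
  (forall i, iter i T x \in dom A) -> iter n A x = iter n T x.
Proof. by move=> AT Ax; elim: n => //= n ->; case: (AT _ (Ax n)). Qed.

Lemma extends_iterl A T n x : extends A T ->
  (forall i, iter i A x \in dom A) -> iter n A x = iter n T x.
Proof. by move=> AT Ax; elim: n => //= n <-; case: (AT _ (Ax n)). Qed.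

Lemma extends_ker A T n x : extends A T ->
  x \in ker (pow_op A n) -> x \in ker (pow_op T n).
Proof.
move=> AT /mem_ker_pow[Ax x0]; apply/mem_ker_pow.
split=> [i|]; rewrite -(extends_iterl _ AT) //.
by case: (AT _ (Ax i)).
Qed.

(** The first kernel keeps all iterates inside [dom A]; the second makes the [n]th one vanish. *)
Lemma extends_kerI A T m n x : extends A T ->
  x \in ker (pow_op A m) -> x \in ker (pow_op T n) -> x \in ker (pow_op A n).
Proof.
move=> AT /mem_ker_pow[Ax _] /mem_ker_pow[_ x0]; apply/mem_ker_pow.
by split=> //; rewrite (extends_iterl _ AT).
Qed.

(* Let [p] be the largest power for which some [T^p z], [z] in [ker T^(n+1)],
   leaves [dom A].  Subtracting suitable multiples of [z, T z, ..., T^p z] from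
   [x] brings [T^p x, ..., T x, x] successively into [dom A]; all those
   corrections but the first lie in [ker T^n]. *)
Lemma codim1_ker A T n : extends A T -> codim1 (dom T) (dom A) ->
  spans_mod (ker (pow_op T n.+1))
    (addsp (ker (pow_op A n.+1)) (ker (pow_op T n))) 1.
Proof.
move=> AT cTA; pose N := ker (pow_op T n.+1).
pose good p := forall x, x \in N -> forall i, (p <= i)%N -> iter i T x \in dom A.
have goodn : good n.+1.
  by move=> x /mem_ker_pow[_ x0] i ni; rewrite (iter_linop_eq0 ni x0) rpred0.
have goodA x : (forall i, iter i T x \in dom A) -> x \in N ->
    x \in ker (pow_op A n.+1).
  move=> Ax /mem_ker_pow[_ x0]; apply/mem_ker_pow.
  by split=> [i|]; rewrite (extends_iterr _ AT).
have [good0|ngood0] := pselect (good 0%N).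
  apply: spans_mod_sub => x Nx; apply/asboolP; exists x.
    by apply: goodA => // i; apply: good0.
  by rewrite subrr rpred0.
have [p [goodp ngoodp]] : exists p, good p.+1 /\ ~ good p.
  elim: n.+1 goodn => // m IHm gm.
  by have [/IHm|ngm] := pselect (good m); last by exists m.
have [z Nz znA] : exists2 z, z \in N & iter p T z \notin dom A.
  apply: contrapT => nz; apply: ngoodp => x Nx i.
  rewrite leq_eqVlt => /predU1P[<-|pi]; last exact: goodp.
  by apply: contrapT => /negP nx; apply: nz; exists x.
have /mem_ker_pow[Tz z0] := Nz.
have NTz q : iter q T z \in N.
  apply/mem_ker_pow; split=> [i|]; first by rewrite -iterD.
  by rewrite -iterD; apply: iter_linop_eq0 z0; rewrite leq_addr.
(* After [q] corrections, the iterates of [y] of order above [p - q] lie in [dom A]. *)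
have correct x q : (q <= p.+1)%N -> x \in N -> exists c y,
    [/\ y \in N, forall i, (p < i + q)%N -> iter i T y \in dom A
      & x - c *: z - y \in ker (pow_op T n)].
  move=> + Nx; elim: q => [_|q IHq qp].
    exists 0, x; split=> // [i|]; first by rewrite addn0; apply: goodp.
    by rewrite scale0r subr0 subrr rpred0.
  have [c [y [Ny Ay xy]]] := IHq (ltnW qp).
  have /mem_ker_pow[Ty _] := Ny.
  (* The next iterate to repair is the one of order [p - q]. Subtracting a multiple of [T^q z] does
     so, as [T^(p-q)] sends it to [T^p z]; at higher orders it contributes only vectors of [dom A],
     by [goodp]. *)
  have [a Ha] := cTA _ _ (Ty (p - q)%N) (Tz p) znA.
  pose w := iter q T z; have Nw : w \in N by apply: NTz.
  have /mem_ker_pow[Tw _] := Nw.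
  (* Only the correction with [q = 0] is a multiple of [z] itself; the later ones are absorbed in
     [ker T^n]. *)
  exists (if q == 0%N then c + a else c), (y - a *: w); split.
  - by rewrite submodB ?rpredZ.
  - move=> i; rewrite addnS ltnS leq_eqVlt => /predU1P[piq|piq].
      by rewrite iter_linopB // /w -iterD -piq -(addnK q i) -piq.
    rewrite iter_linopB // submodB ?Ay // rpredZ // /w -iterD.
    exact: goodp.
  - rewrite opprB; case: eqP => [q0|/eqP q0].
      by rewrite /w q0 /= scalerDl opprD !addrA subrK.
    rewrite [_ *: w - y]addrC addrA rpredD //.
    apply: rpredZ; apply/mem_ker_pow; split=> //.
    by rewrite -iterD; apply: iter_linop_eq0 z0; rewrite -addn1 leq_add2l lt0n.
exists (fun=> z) => x Nx.
have [c [y [Ny Ay xy]]] := correct x p.+1 (leqnn _) Nx.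
exists (fun=> c); rewrite big_ord1; apply/asboolP; exists y => //.
by apply: goodA => // i; apply: Ay; rewrite ltn_addl.
Qed.

(** * Extensions of arbitrary finite codimension and the resulting kernel bounds *)

Section Restriction.
Variables (T : linop X) (U : submodClosed X) (UT : {subset U <= dom T}).

Fact restr_op_linear (a : F) (x y : X) : x \in U -> y \in U ->
  T (a *: x + y) = a *: T x + T y.
Proof. by move=> /UT Tx /UT Ty; rewrite linopP. Qed.

Definition restr_op : linop X := LinOp restr_op_linear.

End Restriction.

(** Insert a restriction [T'] of [T], of codimension at most 1, that still extends [A]. One vector
    leads from [T] to [T'], [k] more from [T'] to [A], and [ker T'^n] lies in [ker T^n]. *)
Lemma extends_ker_step A T n k : extends A T -> spans_mod (dom T) (dom A) k ->
  spans_mod (ker (pow_op T n.+1))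
    (addsp (ker (pow_op A n.+1)) (ker (pow_op T n))) k.
Proof.
elim: k T => [|k IHk] T AT.
  (* With no generators [dom T] is contained in [dom A], so [A] in turn extends [T]. *)
  case=> e He; apply: spans_mod_sub => x Tx; apply/asboolP; exists x.
    have TA y : y \in dom T -> y \in dom A.
      by move=> /He[c]; rewrite big_ord0 subr0.
    move: Tx; apply: extends_ker => y /TA Ay.
    by have [_ ->] := AT _ Ay.
  by rewrite subrr rpred0.
case/spans_modS=> U [UT TAU cTU sU].
pose T' := restr_op UT.
have AT' : extends A T'.
  by move=> x Ax; have [Tx ?] := AT _ Ax; split=> //; apply: TAU.
have T'T : extends T' T by move=> x /UT.
have /spans_mod_addsp : spans_mod (ker (pow_op T n.+1))
    (addsp (ker (pow_op T' n.+1))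
           (addsp (ker (pow_op A n.+1)) (ker (pow_op T n)))) 1.
  apply: spans_modSr (codim1_ker n T'T cTU) => x _ /asboolP[y T'y Txy].
  apply/asboolP; exists y => //; apply/asboolP.
  by exists 0; rewrite ?rpred0 ?subr0.
apply; apply: spans_modSr (IHk T' AT' sU) => x _ /asboolP[y Ay T'xy].
by apply/asboolP; exists y => //; apply: extends_ker T'xy.
Qed.

Lemma ker_quot_spans A S T k n d : extends A S -> extends A T ->
  spans_mod (dom T) (dom A) k ->
  spans_mod (ker (pow_op S n.+1)) (ker (pow_op S n)) d ->
  spans_mod (ker (pow_op T n.+1)) (ker (pow_op T n)) (k + d).
Proof.
move=> AS AT sTA sS; apply: spans_mod_addsp (extends_ker_step n AT sTA) _.
(* The [d] generators for [S] also serve [ker A^(n+1)], whose intersection with [ker S^n] lies in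
   [ker A^n], hence in [ker T^n]. *)
apply: (spans_modSr (V := ker (pow_op S n))) => [x Ax Sx|].
  by apply: extends_ker AT _; apply: extends_kerI Ax Sx.
by apply: spans_modSl sS => x; apply: extends_ker.
Qed.

Lemma ker_spans A T k n : extends A T -> spans_mod (dom T) (dom A) k ->
  spans_mod (ker (pow_op T n)) (ker (pow_op A n)) (k * n).
Proof.
move=> AT sTA; elim: n => [|n IHn]; first exact: spans_mod_sub.
rewrite mulnS; apply: (spans_mod_addsp (V := ker (pow_op T n))).
  apply: spans_modSr (extends_ker_step n AT sTA) => x _ /asboolP[y Ay Txy].
  (* The complementary component is the witness because the two summands change places. *)
  by apply/asboolP; exists (x - y); rewrite // subKr.
apply: spans_modSr IHn => x _ /mem_ker_pow[Ax x0]; apply/mem_ker_pow.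
by split=> //; apply: iter_linop_eq0 x0.
Qed.

Lemma ker_spans0 A S T k n d : extends A S -> extends A T ->
  spans_mod (dom T) (dom A) k ->
  spans_mod (ker (pow_op S n)) (ker (id_op X)) d ->
  spans_mod (ker (pow_op T n)) (ker (id_op X)) (k * n + d).
Proof.
move=> AS AT sTA sS; apply: spans_mod_trans (ker_spans n AT sTA) _.
by apply: spans_modSl sS => x; apply: extends_ker.
Qed.

End Extension.

Theorem theorem2p2 (R : realType) (s : scalar_kind)
    (X : lmodType (scalars R s)) (S T : linop X) (k : nat) :
  (exists M : submodClosed X,
     [/\ forall x, x \in M -> x \in dom S /\ x \in dom T,
         forall x, x \in M -> S x = T x,
         fin_dim_quot (dom S) M,
         fin_dim_quot (dom T) M
       & maxn (dim_quot (dom S) M) (dim_quot (dom T) M) = k]) ->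
  forall l : scalars R s,
    (forall n : nat, (0 < n)%N ->
       fin_dim (ker_shift_pow S l n) ->
       fin_dim (ker_shift_pow T l n) /\
       `| (subdim (ker_shift_pow S l n))%:Z - (subdim (ker_shift_pow T l n))%:Z |
         <= (k * n)%:Z)
    /\
    (forall n : nat, (0 < n)%N ->
       fin_dim_quot (ker_shift_pow S l n.+1) (ker_shift_pow S l n) ->
       fin_dim_quot (ker_shift_pow T l n.+1) (ker_shift_pow T l n) /\
       `| (dim_quot (ker_shift_pow S l n.+1) (ker_shift_pow S l n))%:Z
          - (dim_quot (ker_shift_pow T l n.+1) (ker_shift_pow T l n))%:Z |
         <= k%:Z).
Proof.
move=> [M [MST eqST fS fT dk]] l.
have MS : {subset M <= dom (shift_op S l)} by move=> x /MST[].
pose A := restr_op MS.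
have AS : extends A (shift_op S l) by move=> x /MS.
have AT : extends A (shift_op T l).
  by move=> x Mx; split; [case: (MST x Mx)|rewrite /= eqST].
have sS : spans_mod (dom (shift_op S l)) (dom A) k.
  by apply/spans_modP; rewrite -dk leq_maxl.
have sT : spans_mod (dom (shift_op T l)) (dom A) k.
  by apply/spans_modP; rewrite -dk leq_maxr.
split=> n _ fSn.
  (* The exact dimension for [S] serves as the bound [d]. The finiteness so obtained for [T] allows
     the same argument with the roles exchanged, which gives the reverse inequality. *)
  have /spans_mod0P[fTn leT] :=
    ker_spans0 AS AT sT ((spans_mod0P _ _).2 (conj fSn (leqnn _))).
  have /spans_mod0P[_ leS] :=
    ker_spans0 AT AS sS ((spans_mod0P _ _).2 (conj fTn (leqnn _))).
  by split=> //; move: leT leS; lia.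
have /spans_modP[fTn leT] :=
  ker_quot_spans AS AT sT ((spans_modP _ _ _).2 (conj fSn (leqnn _))).
have /spans_modP[_ leS] :=
  ker_quot_spans AT AS sS ((spans_modP _ _ _).2 (conj fTn (leqnn _))).
by split=> //; move: leT leS; lia.
Qed.
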